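(* Let $\gamma_0\in Y$ be non-trivial, and let $\gamma_n=\varphi^n(\gamma_0)$ for $n\ge 0$. Then the length of $\gamma_n$ tends to infinity as $n\to\infty$.
   Context: Smooth means $C^\infty$. $Y$ is the set of smooth immersed curves $\gamma:[a,b]\to\mathbb{R}^2$ (with $a<b$; self-intersections allowed) such that: $\gamma(a)=(0,0)$ and $\gamma(b)=(1,0)$; with respect to the arc length parameter, the first derivative of $\gamma$ at both endpoints equals $(1,0)$; and with respect to the arc length parameter, all derivatives of $\gamma$ of order $\ge 2$ vanish at both endpoints. The map $\varphi:Y\to Y$ is defined by $\varphi(\gamma)(t)=\gamma(t)+\frac{\dot\gamma(t)}{\|\dot\gamma(t)\|}-(1,0)$, so $\varphi(\gamma)$ is parametrized by the same interval as $\gamma$; $\varphi^n$ denotes the $n$-fold iterate. A curve in $Y$ is trivial if its image is the straight segment from $(0,0)$ to $(1,0)$. *)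

(* Defs.v *)
From Stdlib Require Import Reals ClassicalEpsilon.
From Coquelicot Require Import Coquelicot.
Open Scope R_scope.

(** Coquelicot's [norm] on [R * R] is the Euclidean norm. *)
Definition plane := (R * R)%type.

(** Derivatives are taken relative to the closed segment [[a, b]]: two-sided in
    the interior, one-sided at [a] and [b].  Values of [f] outside [[a, b]] play
    no role. *)
Definition is_deriv_on (a b : R) (f : R -> plane) (t : R) (l : plane) : Prop :=
  filterlim (fun u => scal (/ (u - t)) (minus (f u) (f t)))
    (within (fun u => a <= u <= b) (locally' t)) (locally l).

(** For [t] in [[a, b]], [a < b], the derivative is unique when it exists; the
    value is arbitrary when it does not. *)
Definition deriv_on (a b : R) (f : R -> plane) (t : R) : plane :=
  epsilon (inhabits (0, 0)) (is_deriv_on a b f t).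

Fixpoint deriv_on_n (a b : R) (f : R -> plane) (k : nat) : R -> plane :=
  match k with
  | O => f
  | S k' => deriv_on a b (deriv_on_n a b f k')
  end.

Definition smooth_on (a b : R) (f : R -> plane) : Prop :=
  forall (k : nat) (t : R), a <= t <= b ->
    exists l : plane, is_deriv_on a b (deriv_on_n a b f k) t l.

(** A parametrized curve on [[lo, hi]]; only the values of [pt] on that segment
    are meaningful. *)
Record curve := Curve { lo : R; hi : R; pt : R -> plane }.

Definition velocity (g : curve) : R -> plane := deriv_on (lo g) (hi g) (pt g).

Definition unit_tangent (g : curve) (t : R) : plane :=
  scal (/ norm (velocity g t)) (velocity g t).

Definition arc_length (g : curve) (t : R) : R :=
  RInt (fun u => norm (velocity g u)) (lo g) t.

Definition curve_length (g : curve) : R := arc_length g (hi g).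

Definition smooth_immersed (g : curve) : Prop :=
  lo g < hi g /\
  smooth_on (lo g) (hi g) (pt g) /\
  forall t : R, lo g <= t <= hi g -> velocity g t <> (0, 0).

(** The reparametrization of [g] by arc length, on [[0, curve_length g]].  For
    a smooth immersed curve [arc_length g] is a bijection from [[lo g, hi g]]
    onto this segment, so the choice below is forced. *)
Definition by_arc_length (g : curve) (s : R) : plane :=
  pt g (epsilon (inhabits (lo g))
         (fun t => lo g <= t <= hi g /\ arc_length g t = s)).

Definition arc_length_deriv (g : curve) (k : nat) : R -> plane :=
  deriv_on_n 0 (curve_length g) (by_arc_length g) k.

Definition Y (g : curve) : Prop :=
  smooth_immersed g /\
  pt g (lo g) = (0, 0) /\ pt g (hi g) = (1, 0) /\
  arc_length_deriv g 1 0 = (1, 0) /\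
  arc_length_deriv g 1 (curve_length g) = (1, 0) /\
  forall k : nat, (2 <= k)%nat ->
    arc_length_deriv g k 0 = (0, 0) /\
    arc_length_deriv g k (curve_length g) = (0, 0).

(** Total on [curve]; it is used only on curves satisfying [Y], a class it
    preserves. *)
Definition phi (g : curve) : curve :=
  Curve (lo g) (hi g)
    (fun t => minus (plus (pt g t) (unit_tangent g t)) (1, 0)).

Definition trivial (g : curve) : Prop :=
  forall p : plane,
    (exists t : R, lo g <= t <= hi g /\ pt g t = p) <->
    (exists x : R, 0 <= x <= 1 /\ p = (x, 0)).

(* Main.v *)
Require Import Defs.
From Stdlib Require Import Reals Lra Lia ClassicalEpsilon Classical.
From Coquelicot Require Import Coquelicot.
Open Scope R_scope.

(** Write [v] for the speed of a curve and [T] for its unit tangent.  Since [T']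
    is orthogonal to [T], the image under [phi] has speed [sqrt (v^2 + |T'|^2)].
    So lengths do not decrease along the iteration, and a step that gains
    little length leaves little room for [|T'|]: the total turning of the tangent
    is controlled by the gain ([length_gain]).  As [T] starts at [(1, 0)], a curve
    that turns little runs almost horizontally, and since its endpoints are at
    distance [1] its length is close to [1].

    The length of a non-trivial curve of the class exceeds [1]
    ([short_trivial]).  If the lengths were bounded, they would stay away from
    [1] from the start, hence every step would gain at least a fixed positive
    amount ([length_gain_uniform]), which contradicts boundedness.

    For this argument the unit tangent of every iterate must equal [(1, 0)] at
    both ends: this keeps the endpoints fixed and starts the turning estimate.
    The derivative of [T] enters [phi], the second derivative enters the next
    step, and so on; this is where the vanishing of all higher derivatives is
    spent. It is carried along the iteration as a condition on the ordinate
    alone: all its derivatives in the original parameter vanish at both ends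
    ([admissible], [phi_admissible]). [Y_admissible] obtains that condition from
    the one on arc-length derivatives. *)

(** * Differentiation on a closed interval *)

(** Asking for an extension of [f] that is differentiable in the ordinary sense
    makes one-sided derivatives at [a] and [b] inherit every rule of the
    two-sided calculus.  The extension may depend on [t], so that the tangent
    line can be used outside the interval. *)
Definition deriv_in (a b : R) (f : R -> R) (t l : R) : Prop :=
  exists g : R -> R,
    (forall u, a <= u <= b -> g u = f u) /\ derivable_pt_lim g t l.

Lemma deriv_in_ext a b f g t l :
  (forall u, a <= u <= b -> f u = g u) -> deriv_in a b f t l -> deriv_in a b g t l.
Proof.
  intros E (h & Hh & D). exists h. split; [|exact D].
  intros u Hu. rewrite (Hh u Hu). exact (E u Hu).
Qed.

Lemma deriv_in_const a b c t : deriv_in a b (fun _ => c) t 0.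
Proof. exists (fct_cte c). split; [easy|]. apply derivable_pt_lim_const. Qed.

Lemma deriv_in_id a b t : deriv_in a b (fun u => u) t 1.
Proof. exists id. split; [easy|]. apply derivable_pt_lim_id. Qed.

Lemma deriv_in_plus a b f g t l m :
  deriv_in a b f t l -> deriv_in a b g t m ->
  deriv_in a b (fun u => f u + g u) t (l + m).
Proof.
  intros (f1 & Ef & Df) (g1 & Eg & Dg). exists (plus_fct f1 g1). split.
  - intros u Hu. unfold plus_fct. now rewrite Ef, Eg.
  - now apply derivable_pt_lim_plus.
Qed.

Lemma deriv_in_mult a b f g t l m :
  a <= t <= b -> deriv_in a b f t l -> deriv_in a b g t m ->
  deriv_in a b (fun u => f u * g u) t (l * g t + f t * m).
Proof.
  intros Ht (f1 & Ef & Df) (g1 & Eg & Dg). exists (mult_fct f1 g1). split.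
  - intros u Hu. unfold mult_fct. now rewrite Ef, Eg.
  - rewrite <- (Ef t Ht), <- (Eg t Ht). now apply derivable_pt_lim_mult.
Qed.

Lemma deriv_in_scal a b c f t l :
  deriv_in a b f t l -> deriv_in a b (fun u => f u * c) t (l * c).
Proof.
  intros (f1 & Ef & Df). exists (mult_real_fct c f1). split.
  - intros u Hu. unfold mult_real_fct. rewrite (Ef u Hu). apply Rmult_comm.
  - rewrite Rmult_comm. now apply derivable_pt_lim_scal.
Qed.

Lemma deriv_in_minus a b f g t l m :
  deriv_in a b f t l -> deriv_in a b g t m ->
  deriv_in a b (fun u => f u - g u) t (l - m).
Proof.
  intros (f1 & Ef & Df) (g1 & Eg & Dg). exists (minus_fct f1 g1). split.
  - intros u Hu. unfold minus_fct. now rewrite Ef, Eg.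
  - now apply derivable_pt_lim_minus.
Qed.

Lemma deriv_in_comp a b c d f h s l m :
  (forall u, c <= u <= d -> a <= h u <= b) -> c <= s <= d ->
  deriv_in a b f (h s) l -> deriv_in c d h s m ->
  deriv_in c d (fun u => f (h u)) s (l * m).
Proof.
  intros Hh Hs (f1 & Ef & Df) (h1 & Eh & Dh). exists (comp f1 h1). split.
  - intros u Hu. unfold comp. rewrite (Eh u Hu). apply Ef. now apply Hh.
  - apply derivable_pt_lim_comp; [exact Dh|]. now rewrite (Eh s Hs).
Qed.

Lemma deriv_in_outer_comp a b f F t l m :
  a <= t <= b -> deriv_in a b f t l -> derivable_pt_lim F (f t) m ->
  deriv_in a b (fun u => F (f u)) t (m * l).
Proof.
  intros Ht (f1 & Ef & Df) DF. exists (comp F f1). split.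
  - intros u Hu. unfold comp. now rewrite Ef.
  - apply derivable_pt_lim_comp; [exact Df|]. now rewrite (Ef t Ht).
Qed.

Definition punctured_segment (a b t : R) : (R -> Prop) -> Prop :=
  within (fun u => a <= u <= b) (locally' t).

Lemma punctured_segment_proper a b t :
  a < b -> a <= t <= b -> ProperFilter' (punctured_segment a b t).
Proof.
  intros Hab Ht. split.
  - intros [e He].
    (* a step of half the radius, directed into the segment *)
    set (h := Rmin (e / 2) ((b - a) / 2)).
    assert (Hh : 0 < h /\ h <= e / 2 /\ h <= (b - a) / 2).
    { pose proof (cond_pos e). unfold h. split; [apply Rmin_glb_lt; lra|].
      split; [apply Rmin_l|apply Rmin_r]. }
    pose proof (cond_pos e).
    destruct (Rle_lt_dec t ((a + b) / 2)) as [L|L].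
    + apply (He (t + h)); [|lra|lra].
      change (Rabs (t + h - t) < e). apply Rabs_def1; lra.
    + apply (He (t - h)); [|lra|lra].
      change (Rabs (t - h - t) < e). apply Rabs_def1; lra.
  - unfold punctured_segment. apply within_filter. apply within_filter.
    apply locally_filter.
Qed.

Lemma deriv_in_filterlim a b f t l :
  a <= t <= b ->
  deriv_in a b f t l <->
  filterlim (fun u => (f u - f t) / (u - t)) (punctured_segment a b t) (locally l).
Proof.
  intros Ht. split.
  - intros (g & Eg & Dg) P [e He].
    destruct (Dg e (cond_pos e)) as [d Hd]. exists d.
    intros u Hu Hne Hab. apply He.
    change (Rabs (u - t) < d) in Hu.
    change (Rabs ((f u - f t) / (u - t) - l) < e).
    rewrite <- (Eg u Hab), <- (Eg t Ht).
    replace (g u) with (g (t + (u - t))) by (f_equal; ring).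
    apply Hd; [lra|exact Hu].
  - intros L. exists (fun u => if excluded_middle_informative (a <= u <= b)
                               then f u else f t + l * (u - t)). split.
    + intros u Hu. destruct (excluded_middle_informative (a <= u <= b)); tauto.
    + intros e He.
      destruct (L (fun z => Rabs (z - l) < e)) as [d Hd].
      { exists (mkposreal e He). intros z Hz. exact Hz. }
      exists d. intros h Hh Hhd.
      destruct (excluded_middle_informative (a <= t <= b)) as [_|]; [|tauto].
      destruct (excluded_middle_informative (a <= t + h <= b)) as [Hi|Hi].
      * replace h with (t + h - t) at 2 by ring.
        apply Hd; [|lra|exact Hi].
        change (Rabs (t + h - t) < d). now replace (t + h - t) with h by ring.
      * replace (_ - l) with 0 by (field; exact Hh). now rewrite Rabs_R0.
Qed.

Lemma deriv_in_unique a b f t l m :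
  a < b -> a <= t <= b -> deriv_in a b f t l -> deriv_in a b f t m -> l = m.
Proof.
  intros Hab Ht Dl Dm.
  apply (deriv_in_filterlim a b f t l Ht) in Dl.
  apply (deriv_in_filterlim a b f t m Ht) in Dm.
  exact (@filterlim_locally_unique R R_AbsRing R_NormedModule _
    (punctured_segment_proper a b t Hab Ht) _ l m Dl Dm).
Qed.

Lemma is_deriv_on_components a b f t l :
  a <= t <= b ->
  is_deriv_on a b f t l <->
  deriv_in a b (fun u => fst (f u)) t (fst l) /\
  deriv_in a b (fun u => snd (f u)) t (snd l).
Proof.
  intros Ht. rewrite !deriv_in_filterlim by exact Ht.
  assert (E : forall u : R, scal (/ (u - t)) (minus (f u) (f t)) =
    ((fst (f u) - fst (f t)) / (u - t), (snd (f u) - snd (f t)) / (u - t))).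
  { intros u. destruct (f u) as [x y], (f t) as [x0 y0]. cbn [fst snd].
    transitivity (/ (u - t) * (x - x0), / (u - t) * (y - y0)); [reflexivity|].
    f_equal; apply Rmult_comm. }
  unfold is_deriv_on.
  split.
  - intros H. split.
    + eapply filterlim_ext; [|eapply filterlim_comp; [exact H|]].
      2: destruct l; apply continuous_fst.
      intros u. cbv beta. now rewrite E.
    + eapply filterlim_ext; [|eapply filterlim_comp; [exact H|]].
      2: destruct l; apply continuous_snd.
      intros u. cbv beta. now rewrite E.
  - intros [H1 H2].
    intros P [e He].
    destruct (H1 (ball (fst l) e)) as [d1 Hd1]; [now exists e|].
    destruct (H2 (ball (snd l) e)) as [d2 Hd2]; [now exists e|].
    assert (Hd : 0 < Rmin d1 d2) by (apply Rmin_pos; apply cond_pos).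
    exists (mkposreal _ Hd). intros u Hu Hne Hab. apply He. rewrite E.
    change (Rabs (u - t) < Rmin d1 d2) in Hu.
    pose proof (Rmin_l d1 d2). pose proof (Rmin_r d1 d2).
    split; cbn [fst snd].
    + apply Hd1; [|exact Hne|exact Hab].
      change (Rabs (u - t) < d1). lra.
    + apply Hd2; [|exact Hne|exact Hab].
      change (Rabs (u - t) < d2). lra.
Qed.

Lemma deriv_on_components a b f t l1 l2 :
  a < b -> a <= t <= b ->
  deriv_in a b (fun u => fst (f u)) t l1 ->
  deriv_in a b (fun u => snd (f u)) t l2 ->
  deriv_on a b f t = (l1, l2).
Proof.
  intros Hab Ht D1 D2. unfold deriv_on.
  assert (E : is_deriv_on a b f t (epsilon (inhabits (0, 0)) (is_deriv_on a b f t))).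
  { apply epsilon_spec. exists (l1, l2). now apply is_deriv_on_components. }
  apply is_deriv_on_components in E; [|exact Ht]. destruct E as [E1 E2].
  rewrite (surjective_pairing (epsilon _ _)). f_equal;
  eapply deriv_in_unique; eassumption.
Qed.

(** Constant continuation beyond the endpoints turns continuity relative to the
    segment into continuity on the whole line, as the theorems on integrals,
    extrema and intermediate values require. *)
Definition clamp (a b u : R) : R := Rmax a (Rmin b u).

Lemma clamp_in a b u : a <= b -> a <= clamp a b u <= b.
Proof.
  intros H. unfold clamp. split; [apply Rmax_l|].
  apply Rmax_lub; [exact H|apply Rmin_l].
Qed.

Lemma clamp_id a b u : a <= u <= b -> clamp a b u = u.
Proof.
  intros H. unfold clamp. rewrite Rmin_right by lra. apply Rmax_right. lra.
Qed.

Lemma clamp_lipschitz a b u t : Rabs (clamp a b u - clamp a b t) <= Rabs (u - t).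
Proof.
  unfold clamp, Rmax, Rmin, Rabs.
  repeat (destruct (Rle_dec _ _) || destruct (Rcase_abs _)); lra.
Qed.

Lemma clamp_continuous a b f df :
  a <= b -> (forall t, a <= t <= b -> deriv_in a b f t (df t)) ->
  continuity (fun u => f (clamp a b u)).
Proof.
  intros Hab D t.
  destruct (D _ (clamp_in a b t Hab)) as (g & Eg & Dg).
  assert (C : continuity_pt g (clamp a b t)).
  { apply derivable_continuous_pt. exists (df (clamp a b t)). exact Dg. }
  intros e He. destruct (C e He) as (d & Hd & Hc). exists d. split; [exact Hd|].
  intros u [_ Hu]. rewrite <- !Eg by (apply clamp_in; exact Hab).
  destruct (Req_dec (clamp a b t) (clamp a b u)) as [Q|Q].
  - rewrite Q. unfold R_met, dist; cbn. unfold R_dist. rewrite Rminus_diag, Rabs_R0.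
    exact He.
  - apply Hc. split; [split; [exact I|exact Q]|].
    eapply Rle_lt_trans; [apply clamp_lipschitz|exact Hu].
Qed.

Lemma deriv_in_nonneg_le a b f df c d :
  (forall t, a <= t <= b -> deriv_in a b f t (df t)) ->
  (forall t, a <= t <= b -> 0 <= df t) ->
  a <= c -> c <= d -> d <= b -> f c <= f d.
Proof.
  intros D P H1 H2 H3.
  assert (C := clamp_continuous a b f df ltac:(lra) D).
  destruct (MVT_gen (fun u => f (clamp a b u)) c d df) as (x & Hx & E).
  - rewrite Rmin_left, Rmax_right by lra. intros x Hx.
    destruct (D x ltac:(lra)) as (g & Eg & Dg).
    apply is_derive_ext_loc with g; [|now apply is_derive_Reals].
    assert (Hp : 0 < Rmin (x - c) (d - x)) by (apply Rmin_pos; lra).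
    exists (mkposreal _ Hp). intros u Hu.
    change (Rabs (u - x) < Rmin (x - c) (d - x)) in Hu.
    pose proof (Rmin_l (x - c) (d - x)). pose proof (Rmin_r (x - c) (d - x)).
    apply Rabs_def2 in Hu. rewrite clamp_id by lra. apply Eg. lra.
  - intros x _. apply C.
  - rewrite Rmin_left, Rmax_right in Hx by lra.
    rewrite !clamp_id in E by lra.
    pose proof (P x ltac:(lra)). nra.
Qed.

Lemma deriv_in_ivt a b f df y :
  a <= b -> (forall t, a <= t <= b -> deriv_in a b f t (df t)) ->
  f a <= y <= f b -> exists t, a <= t <= b /\ f t = y.
Proof.
  intros Hab D Hy.
  destruct (IVT_gen (fun u => f (clamp a b u)) a b y) as (x & Hx & E).
  - now apply clamp_continuous with df.
  - cbv beta. rewrite !clamp_id by lra.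
    rewrite Rmin_left, Rmax_right by lra. exact Hy.
  - rewrite Rmin_left, Rmax_right in Hx by lra. exists x. split; [exact Hx|].
    now rewrite clamp_id in E.
Qed.

Lemma deriv_in_min a b f df :
  a <= b -> (forall t, a <= t <= b -> deriv_in a b f t (df t)) ->
  exists m, a <= m <= b /\ forall t, a <= t <= b -> f m <= f t.
Proof.
  intros Hab D.
  destruct (continuity_ab_min (fun u => f (clamp a b u)) a b Hab) as (m & Hm & Im).
  - intros c _. now apply clamp_continuous with df.
  - exists m. split; [exact Im|]. intros t Ht.
    specialize (Hm t Ht). cbv beta in Hm. now rewrite !clamp_id in Hm.
Qed.

Lemma deriv_in_RInt a b f df :
  a <= b -> (forall t, a <= t <= b -> deriv_in a b f t (df t)) ->
  forall t, a <= t <= b -> deriv_in a b (fun u => RInt f a u) t (f t).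
Proof.
  intros Hab D t Ht.
  assert (C := clamp_continuous a b f df Hab D).
  exists (fun u => RInt (fun x => f (clamp a b x)) a u). split.
  - intros u Hu. apply RInt_ext. intros x Hx.
    rewrite Rmin_left, Rmax_right in Hx by lra. now rewrite clamp_id by lra.
  - apply is_derive_Reals. rewrite <- (clamp_id a b t Ht) at 2.
    apply (is_derive_RInt (fun x => f (clamp a b x)) _ a t).
    + apply filter_forall. intros u.
      apply (@RInt_correct R_CompleteNormedModule).
      apply (@ex_RInt_continuous R_CompleteNormedModule).
      intros z _. apply continuity_pt_filterlim, C.
    + apply continuity_pt_filterlim, C.
Qed.

(** * Smooth functions and their zeros of infinite order *)

(** One predicate covers differentiability of order [k], where [Z] is empty, and
    the vanishing of the derivatives of order [< k] at the endpoints, so that a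
    single product rule serves both.  The derivative is quantified at each level
    rather than fixed beforehand: closure under an operation then needs only the
    corresponding rule of the calculus, not the uniqueness of derivatives. *)
Fixpoint vanishing (a b : R) (Z : R -> Prop) (k : nat) (f : R -> R) : Prop :=
  match k with
  | O => True
  | S k' =>
      (forall p, a <= p <= b -> Z p -> f p = 0) /\
      exists g, (forall t, a <= t <= b -> deriv_in a b f t (g t)) /\
                vanishing a b Z k' g
  end.

Definition flat (a b : R) (Z : R -> Prop) (f : R -> R) : Prop :=
  forall k, vanishing a b Z k f.

Definition nowhere (_ : R) : Prop := False.
Definition endpoint (a b : R) (p : R) : Prop := p = a \/ p = b.

Lemma vanishing_ext a b Z k f g :
  (forall t, a <= t <= b -> f t = g t) -> vanishing a b Z k f -> vanishing a b Z k g.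
Proof.
  destruct k as [|k]; [easy|]. intros E [V (h & D & W)]. split.
  - intros p Hp Zp. rewrite <- (E p Hp). now apply V.
  - exists h. split; [|exact W]. intros t Ht.
    now apply deriv_in_ext with f, D.
Qed.

Lemma vanishing_pred a b Z k f : vanishing a b Z (S k) f -> vanishing a b Z k f.
Proof.
  revert f. induction k as [|k IH]; [easy|].
  intros f [V (h & D & W)]. split; [exact V|].
  exists h. split; [exact D|]. now apply IH.
Qed.

Lemma vanishing_plus a b Z k f g :
  vanishing a b Z k f -> vanishing a b Z k g ->
  vanishing a b Z k (fun t => f t + g t).
Proof.
  revert f g. induction k as [|k IH]; [easy|].
  intros f g [V (f1 & D & W)] [V' (g1 & D' & W')]. split.
  - intros p Hp Zp. rewrite V, V' by assumption. ring.
  - exists (fun t => f1 t + g1 t). split; [|now apply IH].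
    intros t Ht. apply deriv_in_plus; auto.
Qed.

Lemma vanishing_mult a b Z k f g :
  vanishing a b Z k f -> vanishing a b nowhere k g ->
  vanishing a b Z k (fun t => f t * g t).
Proof.
  revert f g. induction k as [|k IH]; [easy|].
  intros f g Vf Vg.
  pose proof (vanishing_pred _ _ _ _ _ Vf) as Vf'.
  pose proof (vanishing_pred _ _ _ _ _ Vg) as Vg'.
  destruct Vf as [V (f1 & D & W)], Vg as [_ (g1 & D' & W')]. split.
  - intros p Hp Zp. rewrite V by assumption. ring.
  - exists (fun t => f1 t * g t + f t * g1 t). split.
    + intros t Ht. apply deriv_in_mult; auto.
    + apply vanishing_plus; apply IH; assumption.
Qed.

Lemma vanishing_const a b k c : vanishing a b nowhere k (fun _ => c).
Proof.
  revert c. induction k as [|k IH]; [easy|]. intros c. split; [easy|].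
  exists (fun _ => 0). split; [|apply IH]. intros t _. apply deriv_in_const.
Qed.

Lemma flat_deriv a b Z f f1 :
  a < b -> flat a b Z f ->
  (forall t, a <= t <= b -> deriv_in a b f t (f1 t)) -> flat a b Z f1.
Proof.
  intros Hab H D k. destruct (H (S k)) as [_ (g & Dg & W)].
  apply vanishing_ext with g; [|exact W].
  intros t Ht. apply (deriv_in_unique a b f t); auto.
Qed.

(** The class of [C^k] functions is stable under [1 / sqrt f] because the
    derivative, [- f' / 2] times the cube of [1 / sqrt f], is a product of
    functions already known to be [C^(k-1)]. *)
Lemma flat_inv_sqrt a b f :
  flat a b nowhere f -> (forall t, a <= t <= b -> 0 < f t) ->
  flat a b nowhere (fun t => / sqrt (f t)).
Proof.
  intros Hf Pf k.
  induction k as [|k IH]; [easy|]. split; [easy|].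
  destruct (Hf (S k)) as [_ (f1 & D & W)].
  exists (fun t => (f1 t * (- / 2)) *
    (/ sqrt (f t) * (/ sqrt (f t) * / sqrt (f t)))).
  split.
  - intros t Ht. pose proof (Pf t Ht) as P.
    replace ((f1 t * _) * _) with
      (- / 2 * (/ sqrt (f t) * (/ sqrt (f t) * / sqrt (f t))) * f1 t) by ring.
    apply (deriv_in_outer_comp a b f (fun x => / sqrt x)); auto.
    apply is_derive_Reals. auto_derive.
    + split; [exact P|]. split; [|easy]. apply Rgt_not_eq. now apply sqrt_lt_R0.
    + pose proof (sqrt_lt_R0 _ P). field. lra.
  - repeat apply vanishing_mult; trivial. apply vanishing_const.
Qed.

Lemma deriv_on_n_shift a b f k :
  deriv_on_n a b f (S k) = deriv_on_n a b (deriv_on a b f) k.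
Proof. induction k as [|k IH]; [easy|]. cbn in *. now rewrite IH. Qed.

Lemma deriv_on_deriv_in a b f t :
  a <= t <= b -> (exists l, is_deriv_on a b f t l) ->
  deriv_in a b (fun u => fst (f u)) t (fst (deriv_on a b f t)) /\
  deriv_in a b (fun u => snd (f u)) t (snd (deriv_on a b f t)).
Proof.
  intros Ht E. apply is_deriv_on_components; [exact Ht|].
  unfold deriv_on. now apply epsilon_spec.
Qed.

Lemma smooth_on_components a b f :
  smooth_on a b f ->
  flat a b nowhere (fun u => fst (f u)) /\ flat a b nowhere (fun u => snd (f u)).
Proof.
  assert (G : forall k f, smooth_on a b f ->
    vanishing a b nowhere k (fun u => fst (f u)) /\
    vanishing a b nowhere k (fun u => snd (f u))).
  { clear f. induction k as [|k IH]; [easy|]. intros f H.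
    destruct (IH (deriv_on a b f)) as [I1 I2].
    { intros j t Ht. rewrite <- deriv_on_n_shift. now apply H. }
    assert (D : forall t, a <= t <= b -> _) by
      (intros t Ht; exact (deriv_on_deriv_in a b f t Ht (H O t Ht))).
    split; (split; [easy|]).
    - exists (fun u => fst (deriv_on a b f u)). split; [apply D|exact I1].
    - exists (fun u => snd (deriv_on a b f u)). split; [apply D|exact I2]. }
  intros H. split; intros k; now apply G.
Qed.

(** * Regular curves *)

Record regular (g : curve) : Prop := {
  regular_segment : lo g < hi g;
  regular_fst : flat (lo g) (hi g) nowhere (fun t => fst (pt g t));
  regular_snd : flat (lo g) (hi g) nowhere (fun t => snd (pt g t));
  regular_velocity : forall t, lo g <= t <= hi g -> velocity g t <> (0, 0)
}.

Definition speed (g : curve) (t : R) : R := norm (velocity g t).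

Lemma smooth_immersed_regular g : smooth_immersed g -> regular g.
Proof.
  intros (H & S & V). apply smooth_on_components in S. destruct S.
  now constructor.
Qed.

Lemma velocity_deriv g t :
  regular g -> lo g <= t <= hi g ->
  deriv_in (lo g) (hi g) (fun u => fst (pt g u)) t (fst (velocity g t)) /\
  deriv_in (lo g) (hi g) (fun u => snd (pt g u)) t (snd (velocity g t)).
Proof.
  intros H Ht. apply deriv_on_deriv_in; [exact Ht|].
  destruct (regular_fst g H 1%nat) as [_ (x1 & D1 & _)].
  destruct (regular_snd g H 1%nat) as [_ (y1 & D2 & _)].
  exists (x1 t, y1 t). apply is_deriv_on_components; [exact Ht|]. split; auto.
Qed.

Lemma velocity_flat g Z :
  regular g ->
  (flat (lo g) (hi g) Z (fun t => fst (pt g t)) ->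
   flat (lo g) (hi g) Z (fun t => fst (velocity g t))) /\
  (flat (lo g) (hi g) Z (fun t => snd (pt g t)) ->
   flat (lo g) (hi g) Z (fun t => snd (velocity g t))).
Proof.
  intros H. pose proof (regular_segment g H).
  split; intros F; (eapply flat_deriv; [assumption|exact F|]);
    intros t Ht; now apply velocity_deriv.
Qed.

Lemma speed_eq g t :
  speed g t = sqrt (fst (velocity g t) * fst (velocity g t)
                    + snd (velocity g t) * snd (velocity g t)).
Proof.
  unfold speed. destruct (velocity g t) as [x y].
  change (sqrt (Rabs x ^ 2 + Rabs y ^ 2) = sqrt (x * x + y * y)).
  rewrite !pow2_abs. f_equal. ring.
Qed.

Lemma speed_square_pos g t :
  regular g -> lo g <= t <= hi g ->
  0 < fst (velocity g t) * fst (velocity g t)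
      + snd (velocity g t) * snd (velocity g t).
Proof.
  intros H Ht. pose proof (regular_velocity g H t Ht) as N.
  destruct (velocity g t) as [x y]. cbn [fst snd].
  destruct (Req_dec x 0) as [->|X]; [|nra].
  destruct (Req_dec y 0) as [->|Y]; [easy|nra].
Qed.

Lemma speed_pos g t : regular g -> lo g <= t <= hi g -> 0 < speed g t.
Proof. intros H Ht. rewrite speed_eq. now apply sqrt_lt_R0, speed_square_pos. Qed.

Lemma speed_square g t :
  regular g -> lo g <= t <= hi g ->
  speed g t * speed g t = fst (velocity g t) * fst (velocity g t)
                          + snd (velocity g t) * snd (velocity g t).
Proof.
  intros H Ht. rewrite speed_eq. apply sqrt_sqrt.
  now apply Rlt_le, speed_square_pos.
Qed.

Lemma inv_speed_smooth g : regular g -> flat (lo g) (hi g) nowhere (fun t => / speed g t).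
Proof.
  intros H k. eapply vanishing_ext; [intros t _; exact (eq_sym (f_equal Rinv (speed_eq g t)))|].
  revert k. apply (flat_inv_sqrt _ _ (fun t => fst (velocity g t) * fst (velocity g t)
      + snd (velocity g t) * snd (velocity g t))).
  - intros k. pose proof (proj1 (velocity_flat g _ H) (regular_fst g H)) as V1.
    pose proof (proj2 (velocity_flat g _ H) (regular_snd g H)) as V2.
    apply vanishing_plus; apply vanishing_mult; (apply V1 || apply V2).
  - intros t Ht. now apply speed_square_pos.
Qed.

Lemma speed_smooth g : regular g -> flat (lo g) (hi g) nowhere (speed g).
Proof.
  intros H k.
  apply vanishing_ext with (fun t => (fst (velocity g t) * fst (velocity g t)
      + snd (velocity g t) * snd (velocity g t)) * / speed g t).
  - intros t Ht. rewrite <- speed_square by assumption.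
    pose proof (speed_pos g t H Ht). field. lra.
  - pose proof (proj1 (velocity_flat g _ H) (regular_fst g H)) as V1.
    pose proof (proj2 (velocity_flat g _ H) (regular_snd g H)) as V2.
    apply vanishing_mult; [apply vanishing_plus; apply vanishing_mult; (apply V1 || apply V2)|].
    now apply inv_speed_smooth.
Qed.

Lemma arc_length_deriv_in g t :
  regular g -> lo g <= t <= hi g ->
  deriv_in (lo g) (hi g) (arc_length g) t (speed g t).
Proof.
  intros H. destruct (speed_smooth g H 1%nat) as [_ (df & D & _)].
  apply deriv_in_RInt with df; [|exact D].
  now apply Rlt_le, regular_segment.
Qed.

Lemma arc_length_lo g : arc_length g (lo g) = 0.
Proof. exact (@RInt_point R_CompleteNormedModule (lo g) (speed g)). Qed.

Lemma unit_tangent_eq g t :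
  unit_tangent g t = (fst (velocity g t) * / speed g t, snd (velocity g t) * / speed g t).
Proof.
  unfold unit_tangent. fold (speed g t). destruct (velocity g t) as [x y]. cbn [fst snd].
  transitivity (/ speed g t * x, / speed g t * y); [reflexivity|].
  f_equal; ring.
Qed.

Lemma unit_tangent_smooth g Z :
  regular g ->
  flat (lo g) (hi g) nowhere (fun t => fst (unit_tangent g t)) /\
  (flat (lo g) (hi g) Z (fun t => snd (pt g t)) ->
   flat (lo g) (hi g) Z (fun t => snd (unit_tangent g t))).
Proof.
  intros H. split; [|intros F]; intros k.
  - eapply vanishing_ext;
      [intros t _; exact (eq_sym (f_equal fst (unit_tangent_eq g t)))|].
    apply vanishing_mult; [|now apply inv_speed_smooth].
    apply (velocity_flat g nowhere H), regular_fst, H.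
  - eapply vanishing_ext;
      [intros t _; exact (eq_sym (f_equal snd (unit_tangent_eq g t)))|].
    apply vanishing_mult; [|now apply inv_speed_smooth].
    now apply (velocity_flat g Z H).
Qed.

Lemma unit_tangent_square g t :
  regular g -> lo g <= t <= hi g ->
  fst (unit_tangent g t) * fst (unit_tangent g t)
  + snd (unit_tangent g t) * snd (unit_tangent g t) = 1.
Proof.
  intros H Ht. rewrite unit_tangent_eq. cbn [fst snd].
  pose proof (speed_square g t H Ht) as Q. pose proof (speed_pos g t H Ht).
  replace (_ + _) with ((fst (velocity g t) * fst (velocity g t)
      + snd (velocity g t) * snd (velocity g t)) * (/ speed g t * / speed g t)) by ring.
  rewrite <- Q. field. lra.
Qed.

(** * One step of the map *)

Lemma phi_pt g t :
  pt (phi g) t = (fst (pt g t) + fst (unit_tangent g t) + - 1,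
                  snd (pt g t) + snd (unit_tangent g t)).
Proof.
  cbn [pt phi]. destruct (pt g t) as [x y], (unit_tangent g t) as [p q]. cbn [fst snd].
  transitivity (x + p + - 1, y + q + - 0); [reflexivity|]. f_equal. ring.
Qed.

(** Since the unit tangent [T] satisfies [|T| = 1], its derivative is orthogonal
    to it; hence [phi] adds to the velocity of the curve a vector orthogonal to
    it.  This is why immersions stay immersions and why the speed grows. *)
Lemma phi_velocity g t :
  regular g -> lo g <= t <= hi g ->
  exists p q,
    deriv_in (lo g) (hi g) (fun u => fst (unit_tangent g u)) t p /\
    deriv_in (lo g) (hi g) (fun u => snd (unit_tangent g u)) t q /\
    velocity (phi g) t = (fst (velocity g t) + p, snd (velocity g t) + q) /\
    fst (velocity g t) * p + snd (velocity g t) * q = 0.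
Proof.
  intros H Ht. pose proof (regular_segment g H) as Hab.
  destruct (unit_tangent_smooth g nowhere H) as [S1 S2].
  specialize (S2 (regular_snd g H)).
  destruct (S1 1%nat) as [_ (p & Dp & _)], (S2 1%nat) as [_ (q & Dq & _)].
  destruct (velocity_deriv g t H Ht) as [D1 D2].
  exists (p t), (q t). split; [auto|]. split; [auto|]. split.
  - apply deriv_on_components; [exact Hab|exact Ht| |].
    + eapply deriv_in_ext; [intros u _; exact (eq_sym (f_equal fst (phi_pt g u)))|]. cbn [fst].
      cbn [lo hi phi]. rewrite <- (Rplus_0_r (_ + p t)).
      apply deriv_in_plus; [|apply deriv_in_const]. apply deriv_in_plus; auto.
    + eapply deriv_in_ext; [intros u _; exact (eq_sym (f_equal snd (phi_pt g u)))|]. cbn [snd].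
      apply deriv_in_plus; auto.
  - set (P := fst (unit_tangent g t)). set (Q := snd (unit_tangent g t)).
    (* twice [T . T' = 0], by differentiating [|T|^2 = 1] *)
    assert (E : (p t * P + P * p t) + (q t * Q + Q * q t) = 0).
    { apply (deriv_in_unique (lo g) (hi g) (fun u =>
        fst (unit_tangent g u) * fst (unit_tangent g u)
        + snd (unit_tangent g u) * snd (unit_tangent g u)) t); trivial.
      - apply deriv_in_plus; apply deriv_in_mult; auto.
      - apply deriv_in_ext with (fun _ => 1); [|apply deriv_in_const].
        intros u Hu. symmetry. now apply unit_tangent_square. }
    pose proof (speed_pos g t H Ht) as V.
    assert (E1 : fst (velocity g t) = speed g t * P).
    { unfold P. rewrite unit_tangent_eq. cbn [fst]. field. lra. }
    assert (E2 : snd (velocity g t) = speed g t * Q).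
    { unfold Q. rewrite unit_tangent_eq. cbn [snd]. field. lra. }
    rewrite E1, E2. nra.
Qed.

(** A flat ordinate and a velocity pointing forward at both ends amount to
    [T = (1, 0)] there with all derivatives of [T] zero.  Unlike a condition
    on arc-length derivatives, these two properties pass to the image under
    [phi] directly: the new ordinate is a sum of two flat functions. *)
Record admissible (g : curve) : Prop := {
  admissible_regular : regular g;
  admissible_snd : flat (lo g) (hi g) (endpoint (lo g) (hi g)) (fun t => snd (pt g t));
  admissible_lo : fst (pt g (lo g)) = 0;
  admissible_hi : fst (pt g (hi g)) = 1;
  admissible_forward : forall t, endpoint (lo g) (hi g) t -> 0 < fst (velocity g t)
}.

Lemma endpoint_in g t :
  regular g -> endpoint (lo g) (hi g) t -> lo g <= t <= hi g.
Proof. intros H. pose proof (regular_segment g H). intros [->| ->]; lra. Qed.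

Lemma unit_tangent_endpoint g t :
  admissible g -> endpoint (lo g) (hi g) t -> unit_tangent g t = (1, 0).
Proof.
  intros H He. destruct H as [H F _ _ Fw].
  pose proof (endpoint_in g t H He) as Ht. specialize (Fw t He).
  assert (Z : snd (velocity g t) = 0).
  { destruct (proj2 (velocity_flat g _ H) F 1%nat) as [V _]. now apply V. }
  rewrite unit_tangent_eq.
  pose proof (speed_square g t H Ht) as Q. pose proof (speed_pos g t H Ht) as P.
  rewrite Z in Q |- *.
  assert (E : speed g t = fst (velocity g t)) by nra.
  rewrite E. f_equal; field; lra.
Qed.

Lemma phi_regular g : regular g -> regular (phi g).
Proof.
  intros H. destruct (unit_tangent_smooth g nowhere H) as [S1 S2].
  specialize (S2 (regular_snd g H)). constructor.
  - exact (regular_segment g H).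
  - intros k. eapply vanishing_ext; [intros t _; exact (eq_sym (f_equal fst (phi_pt g t)))|].
    apply vanishing_plus; [|apply vanishing_const].
    apply vanishing_plus; [apply (regular_fst g H)|apply S1].
  - intros k. eapply vanishing_ext; [intros t _; exact (eq_sym (f_equal snd (phi_pt g t)))|].
    apply vanishing_plus; [apply (regular_snd g H)|apply S2].
  - intros t Ht. destruct (phi_velocity g t H Ht) as (p & q & _ & _ & -> & O).
    pose proof (speed_square_pos g t H Ht) as P.
    intros E. injection E as E1 E2. nra.
Qed.

Lemma phi_admissible g : admissible g -> admissible (phi g).
Proof.
  intros A. pose proof A as [H F X0 X1 Fw].
  pose proof (regular_segment g H).
  constructor.
  - now apply phi_regular.
  - intros k. eapply vanishing_ext; [intros t _; exact (eq_sym (f_equal snd (phi_pt g t)))|].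
    apply vanishing_plus; [apply F|].
    now apply (proj2 (unit_tangent_smooth g (endpoint (lo g) (hi g)) H)).
  - rewrite phi_pt. change (lo (phi g)) with (lo g).
    rewrite unit_tangent_endpoint by (trivial; now left). cbn [fst]. lra.
  - rewrite phi_pt. change (hi (phi g)) with (hi g).
    rewrite unit_tangent_endpoint by (trivial; now right). cbn [fst]. lra.
  - intros t He. change (endpoint (lo g) (hi g) t) in He.
    pose proof (endpoint_in g t H He) as Ht.
    destruct (phi_velocity g t H Ht) as (p & q & _ & _ & -> & O).
    assert (Z : snd (velocity g t) = 0).
    { destruct (proj2 (velocity_flat g _ H) F 1%nat) as [V _]. now apply V. }
    specialize (Fw t He). cbn [fst]. rewrite Z in O. nra.
Qed.

(** The orthogonality of [phi_velocity] turns this into Pythagoras' theorem. *)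
Lemma phi_speed g t p q :
  regular g -> lo g <= t <= hi g ->
  deriv_in (lo g) (hi g) (fun u => fst (unit_tangent g u)) t p ->
  deriv_in (lo g) (hi g) (fun u => snd (unit_tangent g u)) t q ->
  speed (phi g) t * speed (phi g) t = speed g t * speed g t + (p * p + q * q).
Proof.
  intros H Ht Dp Dq. pose proof (regular_segment g H).
  rewrite speed_square, speed_square by (trivial; now apply phi_regular).
  destruct (phi_velocity g t H Ht) as (p' & q' & Dp' & Dq' & -> & O).
  rewrite (deriv_in_unique _ _ _ _ p p') by eassumption.
  rewrite (deriv_in_unique _ _ _ _ q q') by eassumption.
  cbn [fst snd]. nra.
Qed.

Lemma phi_speed_le g t : regular g -> lo g <= t <= hi g -> speed g t <= speed (phi g) t.
Proof.
  intros H Ht. destruct (phi_velocity g t H Ht) as (p & q & Dp & Dq & _ & _).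
  pose proof (phi_speed g t p q H Ht Dp Dq).
  pose proof (speed_pos g t H Ht).
  pose proof (speed_pos (phi g) t (phi_regular g H) Ht). nra.
Qed.

Lemma phi_length_le g : regular g -> curve_length g <= curve_length (phi g).
Proof.
  intros H. pose proof (regular_segment g H).
  cut (arc_length (phi g) (lo g) - arc_length g (lo g)
       <= arc_length (phi g) (hi g) - arc_length g (hi g)).
  { rewrite arc_length_lo. change (lo g) with (lo (phi g)) at 1.
    rewrite arc_length_lo. unfold curve_length. cbn [hi phi]. lra. }
  apply (deriv_in_nonneg_le (lo g) (hi g) (fun u => arc_length (phi g) u - arc_length g u)
    (fun t => speed (phi g) t - speed g t)); try lra.
  - intros t Ht. apply deriv_in_minus; [|now apply arc_length_deriv_in].
    apply (arc_length_deriv_in (phi g)); [now apply phi_regular|exact Ht].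
  - intros t Ht. pose proof (phi_speed_le g t H Ht). lra.
Qed.

(** A curve that gains little length under [phi] is nearly straight.  With [v]
    and [w] the speeds before and after, the tangent turns at rate at most
    [sqrt (w^2 - v^2)], and by the inequality of the means this is at most
    [(w - v) / (2 d) + d (w + v) / 2].  Integrated, this bounds by [C] how far
    the horizontal part of the unit tangent falls below its initial value [1];
    then the horizontal extent of the curve, which is [1], is at least
    [(1 - C)] times its length. *)
Lemma length_gain g d :
  admissible g -> 0 < d ->
  let L := curve_length g in
  let L' := curve_length (phi g) in
  L * (1 - ((L' - L) * / (2 * d) + (L' + L) * (d / 2))) <= 1.
Proof.
  intros A Hd L L'. pose proof A as [H _ X0 X1 _].
  pose proof (regular_segment g H) as Hab.
  pose proof (phi_regular g H) as H'.
  set (a := lo g) in *. set (b := hi g) in *.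
  assert (Hid : 0 < / (2 * d)) by (apply Rinv_0_lt_compat; lra).
  set (S := arc_length g). set (S' := arc_length (phi g)).
  assert (S0 : S a = 0) by apply arc_length_lo.
  assert (S0' : S' a = 0) by apply (arc_length_lo (phi g)).
  assert (DS : forall t, a <= t <= b -> deriv_in a b S t (speed g t))
    by (intros; now apply arc_length_deriv_in).
  assert (DS' : forall t, a <= t <= b -> deriv_in a b S' t (speed (phi g) t))
    by (intros; now apply (arc_length_deriv_in (phi g))).
  set (turn := fun t => (S' t - S t) * / (2 * d) + (S' t + S t) * (d / 2)).
  set (dturn := fun t => (speed (phi g) t - speed g t) * / (2 * d)
                         + (speed (phi g) t + speed g t) * (d / 2)).
  assert (Dturn : forall t, a <= t <= b -> deriv_in a b turn t (dturn t)).
  { intros t Ht. apply deriv_in_plus; apply deriv_in_scal;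
    [apply deriv_in_minus|apply deriv_in_plus]; auto. }
  change (L * (1 - turn b) <= 1).
  assert (B : forall t, a <= t <= b -> 1 - turn b <= fst (unit_tangent g t)).
  { intros t Ht.
    assert (T1 : turn t <= turn b).
    { apply (deriv_in_nonneg_le a b turn dturn); try lra; auto.
      intros u Hu. pose proof (phi_speed_le g u H Hu). pose proof (speed_pos g u H Hu).
      unfold dturn. apply Rplus_le_le_0_compat; apply Rmult_le_pos; lra. }
    destruct (unit_tangent_smooth g nowhere H) as [S1 S2].
    specialize (S2 (regular_snd g H)).
    destruct (S1 1%nat) as [_ (p & Dp & _)], (S2 1%nat) as [_ (q & Dq & _)].
    assert (T2 : fst (unit_tangent g a) + turn a <= fst (unit_tangent g t) + turn t).
    { apply (deriv_in_nonneg_le a b (fun u => fst (unit_tangent g u) + turn u)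
        (fun u => p u + dturn u)); try lra.
      - intros u Hu. apply deriv_in_plus; auto.
      - intros u Hu. unfold dturn.
        pose proof (phi_speed g u (p u) (q u) H Hu (Dp u Hu) (Dq u Hu)) as E.
        pose proof (phi_speed_le g u H Hu) as E1. pose proof (speed_pos g u H Hu) as E2.
        set (v := speed g u) in *. set (w := speed (phi g) u) in *.
        set (x := (w - v) * / (2 * d)). set (y := (w + v) * (d / 2)).
        assert (0 <= x) by (apply Rmult_le_pos; lra).
        assert (0 <= y) by (apply Rmult_le_pos; lra).
        assert (4 * (x * y) = w * w - v * v) by (unfold x, y; field; lra).
        assert (p u * p u <= (x + y) * (x + y)) by
          (pose proof (Rle_0_sqr (x - y)); pose proof (Rle_0_sqr (q u)); unfold Rsqr in *; lra).
        assert (0 <= x + y) by lra. nra. }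
    rewrite unit_tangent_endpoint in T2 by (trivial; now left).
    unfold turn at 1 in T2. rewrite S0, S0' in T2. cbn [fst] in T2. lra. }
  assert (M : fst (pt g a) - S a * (1 - turn b) <= fst (pt g b) - S b * (1 - turn b)).
  { apply (deriv_in_nonneg_le a b (fun u => fst (pt g u) - S u * (1 - turn b))
      (fun u => fst (velocity g u) - speed g u * (1 - turn b))); try lra.
    - intros t Ht. apply deriv_in_minus; [now apply velocity_deriv|].
      apply deriv_in_scal; auto.
    - intros t Ht. specialize (B t Ht). rewrite unit_tangent_eq in B. cbn [fst] in B.
      pose proof (speed_pos g t H Ht) as P.
      apply Rmult_le_compat_r with (r := speed g t) in B; [|lra].
      rewrite Rmult_assoc, Rinv_l, Rmult_1_r in B by lra. lra. }
  rewrite X0, X1, S0 in M. change (S b) with L in M. lra.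
Qed.

(** * Reparametrization by arc length *)

(** That [F] expands distances by a factor at least [m] provides both the
    injectivity and the continuity of the inverse [h]; the difference quotient of
    [h] is then the reciprocal of that of [F] at [h u]. *)
Lemma deriv_in_inverse a b c d F h m s l :
  (forall u, c <= u <= d -> a <= h u <= b /\ F (h u) = u) ->
  0 < m -> (forall x y, a <= x <= b -> a <= y <= b -> m * Rabs (y - x) <= Rabs (F y - F x)) ->
  c <= s <= d -> deriv_in a b F (h s) l -> l <> 0 ->
  deriv_in c d h s (/ l).
Proof.
  intros Hh Hm HF Hs D Hl. destruct (Hh s Hs) as [Is Es].
  apply deriv_in_filterlim in D; [|exact Is].
  apply deriv_in_filterlim; [exact Hs|].
  apply filterlim_within_ext with (fun u => / ((F (h u) - F (h s)) / (h u - h s))).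
  { intros u Hu. rewrite Rinv_div, Es. now rewrite (proj2 (Hh u Hu)). }
  apply filterlim_comp with (locally l); [|now apply continuous_Rinv].
  apply (filterlim_comp _ _ _ h (fun t => (F t - F (h s)) / (t - h s))
           _ (punctured_segment a b (h s))); [|exact D].
  intros P [e He].
  assert (Hp : 0 < m * e) by (apply Rmult_lt_0_compat; [exact Hm|apply cond_pos]).
  exists (mkposreal _ Hp). intros u Hu Hne Hcd.
  change (Rabs (u - s) < m * e) in Hu.
  destruct (Hh u Hcd) as [Iu Eu]. apply He; [| |exact Iu].
  - change (Rabs (h u - h s) < e).
    pose proof (HF (h s) (h u) Is Iu) as Q. rewrite Es, Eu in Q.
    apply Rmult_lt_reg_l with m; lra.
  - intros Q. apply Hne. rewrite <- Es, <- Eu. now rewrite Q.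
Qed.

(** The parameter that [by_arc_length] chooses. *)
Definition arc_parameter (g : curve) (s : R) : R :=
  epsilon (inhabits (lo g)) (fun t => lo g <= t <= hi g /\ arc_length g t = s).

(** The constant is the minimum of the speed. *)
Lemma arc_length_expanding g :
  regular g -> exists m, 0 < m /\
  forall x y, lo g <= x <= hi g -> lo g <= y <= hi g ->
    m * Rabs (y - x) <= Rabs (arc_length g y - arc_length g x).
Proof.
  intros H. pose proof (regular_segment g H) as Hab.
  destruct (speed_smooth g H 1%nat) as [_ (dv & Dv & _)].
  destruct (deriv_in_min _ _ _ _ (Rlt_le _ _ Hab) Dv) as (m & Im & Hm).
  exists (speed g m). split; [now apply speed_pos|].
  assert (P := speed_pos g m H Im).
  assert (G : forall x y, lo g <= x -> x <= y -> y <= hi g ->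
    speed g m * (y - x) <= arc_length g y - arc_length g x).
  { intros x y H1 H2 H3.
    cut (arc_length g x - x * speed g m <= arc_length g y - y * speed g m); [lra|].
    apply (deriv_in_nonneg_le (lo g) (hi g) (fun t => arc_length g t - t * speed g m)
      (fun t => speed g t - 1 * speed g m)); trivial.
    - intros t Ht. apply deriv_in_minus; [now apply arc_length_deriv_in|].
      apply deriv_in_scal, deriv_in_id.
    - intros t Ht. specialize (Hm t Ht). lra. }
  intros x y Hx Hy. destruct (Rle_lt_dec x y) as [L|L].
  - rewrite Rabs_pos_eq by lra.
    eapply Rle_trans; [apply G; lra|apply Rle_abs].
  - rewrite Rabs_minus_sym, (Rabs_minus_sym (arc_length g y)).
    rewrite Rabs_pos_eq by lra.
    eapply Rle_trans; [apply G; lra|apply Rle_abs].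
Qed.

Lemma arc_parameter_spec g s :
  regular g -> 0 <= s <= curve_length g ->
  lo g <= arc_parameter g s <= hi g /\ arc_length g (arc_parameter g s) = s.
Proof.
  intros H Hs. unfold arc_parameter. apply epsilon_spec.
  apply deriv_in_ivt with (speed g).
  - now apply Rlt_le, regular_segment.
  - intros t Ht. now apply arc_length_deriv_in.
  - rewrite arc_length_lo. exact Hs.
Qed.

Lemma curve_length_pos g : regular g -> 0 < curve_length g.
Proof.
  intros H. pose proof (regular_segment g H) as Hab.
  destruct (arc_length_expanding g H) as (m & Hm & E).
  specialize (E (lo g) (hi g) ltac:(lra) ltac:(lra)).
  rewrite arc_length_lo, Rminus_0_r in E. fold (curve_length g) in E.
  rewrite Rabs_pos_eq in E by lra.
  assert (0 <= curve_length g).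
  { rewrite <- (arc_length_lo g).
    apply (deriv_in_nonneg_le (lo g) (hi g) (arc_length g) (speed g)); try lra.
    - intros t Ht. now apply arc_length_deriv_in.
    - intros t Ht. now apply Rlt_le, speed_pos. }
  rewrite Rabs_pos_eq in E by lra. nra.
Qed.

Lemma arc_parameter_arc_length g t :
  regular g -> lo g <= t <= hi g -> arc_parameter g (arc_length g t) = t.
Proof.
  intros H Ht. destruct (arc_length_expanding g H) as (m & Hm & E).
  assert (Q : lo g <= arc_parameter g (arc_length g t) <= hi g /\
    arc_length g (arc_parameter g (arc_length g t)) = arc_length g t).
  { unfold arc_parameter. apply epsilon_spec. now exists t. }
  destruct Q as [I Q]. specialize (E _ _ I Ht).
  rewrite Q, Rminus_diag, Rabs_R0 in E.
  pose proof (Rabs_pos (t - arc_parameter g (arc_length g t))).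
  assert (Z : Rabs (t - arc_parameter g (arc_length g t)) = 0) by nra.
  destruct (Req_dec (t - arc_parameter g (arc_length g t)) 0) as [N|N]; [lra|].
  now apply Rabs_no_R0 in N.
Qed.

Lemma deriv_on_by_arc_length g f h f1 f2 s :
  regular g -> 0 <= s <= curve_length g ->
  (forall u, 0 <= u <= curve_length g -> h u = f (arc_parameter g u)) ->
  (forall t, lo g <= t <= hi g -> deriv_in (lo g) (hi g) (fun u => fst (f u)) t (f1 t)) ->
  (forall t, lo g <= t <= hi g -> deriv_in (lo g) (hi g) (fun u => snd (f u)) t (f2 t)) ->
  deriv_on 0 (curve_length g) h s =
    (f1 (arc_parameter g s) * / speed g (arc_parameter g s),
     f2 (arc_parameter g s) * / speed g (arc_parameter g s)).
Proof.
  intros H Hs E D1 D2.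
  destruct (arc_parameter_spec g s H Hs) as [I _].
  assert (D : deriv_in 0 (curve_length g) (arc_parameter g) s
                (/ speed g (arc_parameter g s))).
  { destruct (arc_length_expanding g H) as (m & Hm & X).
    apply (deriv_in_inverse (lo g) (hi g) 0 (curve_length g) (arc_length g) _ m); trivial.
    - intros u Hu. now apply arc_parameter_spec.
    - now apply arc_length_deriv_in.
    - apply Rgt_not_eq. now apply speed_pos. }
  assert (J : forall u, 0 <= u <= curve_length g -> lo g <= arc_parameter g u <= hi g)
    by (intros u Hu; now apply arc_parameter_spec).
  apply deriv_on_components; [now apply curve_length_pos|exact Hs| |].
  - apply deriv_in_ext with (fun u => fst (f (arc_parameter g u))).
    { intros u Hu. now rewrite E. }
    apply (deriv_in_comp (lo g) (hi g) _ _ (fun t => fst (f t))); auto.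
  - apply deriv_in_ext with (fun u => snd (f (arc_parameter g u))).
    { intros u Hu. now rewrite E. }
    apply (deriv_in_comp (lo g) (hi g) _ _ (fun t => snd (f t))); auto.
Qed.

(** In the original parameter [t], the derivative of [f] is the speed times its
    arc-length derivative, and by the product rule the smooth factor does no
    harm to vanishing derivatives. *)
Lemma vanishing_by_arc_length g k f h :
  regular g ->
  flat (lo g) (hi g) nowhere (fun t => fst (f t)) ->
  flat (lo g) (hi g) nowhere (fun t => snd (f t)) ->
  (forall s, 0 <= s <= curve_length g -> h s = f (arc_parameter g s)) ->
  (forall j, (j < k)%nat ->
     snd (deriv_on_n 0 (curve_length g) h j 0) = 0 /\
     snd (deriv_on_n 0 (curve_length g) h j (curve_length g)) = 0) ->
  vanishing (lo g) (hi g) (endpoint (lo g) (hi g)) k (fun t => snd (f t)).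
Proof.
  intros H. pose proof (regular_segment g H) as Hab.
  pose proof (curve_length_pos g H) as HL.
  assert (P0 : arc_parameter g 0 = lo g).
  { rewrite <- (arc_length_lo g) at 1. apply arc_parameter_arc_length; trivial; lra. }
  assert (P1 : arc_parameter g (curve_length g) = hi g).
  { apply arc_parameter_arc_length; trivial; lra. }
  revert f h. induction k as [|k IH]; [easy|]. intros f h F1 F2 E V. split.
  - intros p _ [-> | ->]; destruct (V O ltac:(lia)) as [V0 V1];
    cbn [deriv_on_n] in V0, V1.
    + rewrite E, P0 in V0 by lra. exact V0.
    + rewrite E, P1 in V1 by lra. exact V1.
  - destruct (F1 1%nat) as [_ (f1 & D1 & _)], (F2 1%nat) as [_ (f2 & D2 & _)].
    pose proof (flat_deriv _ _ _ _ _ Hab F1 D1) as G1.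
    pose proof (flat_deriv _ _ _ _ _ Hab F2 D2) as G2.
    exists f2. split; [exact D2|].
    apply vanishing_ext with (fun t => f2 t * / speed g t * speed g t).
    { intros t Ht. pose proof (speed_pos g t H Ht). field. lra. }
    apply vanishing_mult; [|now apply speed_smooth].
    apply (IH (fun t => (f1 t * / speed g t, f2 t * / speed g t))
              (deriv_on 0 (curve_length g) h)); cbn [fst snd].
    + intros j. apply vanishing_mult; [apply G1|now apply inv_speed_smooth].
    + intros j. apply vanishing_mult; [apply G2|now apply inv_speed_smooth].
    + intros s Hs. now apply (deriv_on_by_arc_length g f).
    + intros j Hj. rewrite <- deriv_on_n_shift. apply V. lia.
Qed.

Lemma Y_admissible g : Y g -> admissible g.
Proof.
  intros (Sm & E0 & E1 & T0 & T1 & T). apply smooth_immersed_regular in Sm as H.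
  pose proof (regular_segment g H) as Hab.
  pose proof (curve_length_pos g H) as HL.
  assert (P0 : arc_parameter g 0 = lo g).
  { rewrite <- (arc_length_lo g) at 1. apply arc_parameter_arc_length; trivial; lra. }
  assert (P1 : arc_parameter g (curve_length g) = hi g).
  { apply arc_parameter_arc_length; trivial; lra. }
  constructor; [exact H| |now rewrite E0|now rewrite E1|].
  - intros k. apply (vanishing_by_arc_length g k _ (by_arc_length g)); trivial.
    + apply (regular_fst g H).
    + apply (regular_snd g H).
    + intros j _. destruct j as [|[|j]].
      * cbn [deriv_on_n]. change (by_arc_length g) with (fun s => pt g (arc_parameter g s)).
        cbv beta. now rewrite P0, P1, E0, E1.
      * change (snd (arc_length_deriv g 1 0) = 0 /\
                snd (arc_length_deriv g 1 (curve_length g)) = 0).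
        now rewrite T0, T1.
      * destruct (T (S (S j)) ltac:(lia)) as [Q0 Q1].
        change (snd (arc_length_deriv g (S (S j)) 0) = 0 /\
                snd (arc_length_deriv g (S (S j)) (curve_length g)) = 0).
        now rewrite Q0, Q1.
  - assert (D : forall s, 0 <= s <= curve_length g -> arc_length_deriv g 1 s =
      (fst (velocity g (arc_parameter g s)) * / speed g (arc_parameter g s),
       snd (velocity g (arc_parameter g s)) * / speed g (arc_parameter g s))).
    { intros s Hs. unfold arc_length_deriv. cbn [deriv_on_n].
      apply (deriv_on_by_arc_length g (pt g) _ (fun t => fst (velocity g t))
               (fun t => snd (velocity g t))); trivial;
        intros t Ht; now apply velocity_deriv. }
    assert (Q : forall x v, 0 < v -> x * / v = 1 -> 0 < x).
    { intros x v Hv E. replace x with (x * / v * v) by (field; lra).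
      rewrite E. lra. }
    intros t [-> | ->].
    + rewrite D, P0 in T0 by lra. injection T0 as T0 _.
      apply Q with (2 := T0). apply speed_pos; trivial; lra.
    + rewrite D, P1 in T1 by lra. injection T1 as T1 _.
      apply Q with (2 := T1). apply speed_pos; trivial; lra.
Qed.

(** * Growth of the length *)

(** Arc length minus the abscissa is nondecreasing; when the total length is at
    most [1], it cannot increase at all, so the velocity is horizontal. *)
Lemma short_trivial g : admissible g -> curve_length g <= 1 -> trivial g.
Proof.
  intros A HL. destruct A as [H F X0 X1 _].
  pose proof (regular_segment g H) as Hab.
  assert (Dx : forall t, lo g <= t <= hi g ->
    deriv_in (lo g) (hi g) (fun u => fst (pt g u)) t (fst (velocity g t)))
    by (intros; now apply velocity_deriv).
  assert (Dy : forall t, lo g <= t <= hi g ->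
    deriv_in (lo g) (hi g) (fun u => snd (pt g u)) t (snd (velocity g t)))
    by (intros; now apply velocity_deriv).
  assert (DS : forall t, lo g <= t <= hi g ->
    deriv_in (lo g) (hi g) (arc_length g) t (speed g t))
    by (intros; now apply arc_length_deriv_in).
  assert (M : forall c d, lo g <= c -> c <= d -> d <= hi g ->
    arc_length g c - fst (pt g c) <= arc_length g d - fst (pt g d)).
  { intros c d. apply (deriv_in_nonneg_le (lo g) (hi g)
      (fun u => arc_length g u - fst (pt g u))
      (fun u => speed g u - fst (velocity g u))).
    - intros t Ht. apply deriv_in_minus; auto.
    - intros t Ht. pose proof (speed_square g t H Ht). pose proof (speed_pos g t H Ht).
      nra. }
  assert (E : forall t, lo g <= t <= hi g -> arc_length g t = fst (pt g t)).
  { intros t Ht. pose proof (M (lo g) t ltac:(lra) ltac:(lra) ltac:(lra)) as M0.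
    pose proof (M t (hi g) ltac:(lra) ltac:(lra) ltac:(lra)) as M1.
    rewrite X0, arc_length_lo in M0. rewrite X1 in M1.
    fold (curve_length g) in M1. lra. }
  assert (V : forall t, lo g <= t <= hi g ->
    0 < fst (velocity g t) /\ snd (velocity g t) = 0).
  { intros t Ht. pose proof (speed_square g t H Ht). pose proof (speed_pos g t H Ht).
    assert (speed g t = fst (velocity g t)).
    { apply (deriv_in_unique (lo g) (hi g) (fun u => fst (pt g u)) t); auto.
      apply deriv_in_ext with (arc_length g); auto. }
    split; nra. }
  assert (Y0 : snd (pt g (lo g)) = 0).
  { destruct (F 1%nat) as [Q _]. apply Q; [lra|now left]. }
  assert (Yt : forall t, lo g <= t <= hi g -> snd (pt g t) = 0).
  { intros t Ht. rewrite <- Y0. apply Rle_antisym.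
    - cut (0 - snd (pt g (lo g)) <= 0 - snd (pt g t)); [lra|].
      apply (deriv_in_nonneg_le (lo g) (hi g) (fun u => 0 - snd (pt g u))
        (fun u => 0 - snd (velocity g u))); try lra.
      + intros u Hu. apply deriv_in_minus; [apply deriv_in_const|auto].
      + intros u Hu. destruct (V u Hu). lra.
    - apply (deriv_in_nonneg_le (lo g) (hi g) (fun u => snd (pt g u))
        (fun u => snd (velocity g u))); try lra; auto.
      intros u Hu. destruct (V u Hu). lra. }
  assert (Xm : forall c d, lo g <= c -> c <= d -> d <= hi g ->
    fst (pt g c) <= fst (pt g d)).
  { intros c d. apply (deriv_in_nonneg_le (lo g) (hi g)
      (fun u => fst (pt g u)) (fun u => fst (velocity g u))); auto.
    intros u Hu. destruct (V u Hu). lra. }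
  intros p. split.
  - intros (t & Ht & <-). exists (fst (pt g t)). split.
    + rewrite <- X0, <- X1. split; apply Xm; lra.
    + rewrite <- (Yt t Ht). apply surjective_pairing.
  - intros (x & Hx & ->).
    destruct (deriv_in_ivt (lo g) (hi g) (fun u => fst (pt g u)) _ x
      (Rlt_le _ _ Hab) Dx) as (t & Ht & Et).
    { cbv beta. rewrite X0, X1. exact Hx. }
    exists t. split; [exact Ht|].
    rewrite (surjective_pairing (pt g t)). cbv beta in Et. now rewrite Et, (Yt t Ht).
Qed.

(** While the lengths stay within [[l, M]], each step gains at least
    [c^2 / (2 M)] where [c = 1 - 1 / l]: this is the estimate of [length_gain]
    for [d = c / (2 M)], the choice that makes the term [d (L' + L) / 2] at most
    [c / 2]. *)
Lemma length_gain_uniform g l M :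
  admissible g -> 1 < l -> l <= curve_length g -> curve_length (phi g) <= M ->
  (1 - / l) * (1 - / l) / (2 * M) <= curve_length (phi g) - curve_length g.
Proof.
  intros A Hl HL HM. pose proof (phi_length_le g (admissible_regular g A)) as Mono.
  set (c := 1 - / l).
  assert (Hi : 0 < / l) by (apply Rinv_0_lt_compat; lra).
  assert (Hc : 0 < c).
  { unfold c. pose proof (Rinv_lt_contravar 1 l ltac:(lra) Hl). rewrite Rinv_1 in *. lra. }
  assert (Hd : 0 < c / (2 * M)) by (apply Rdiv_lt_0_compat; lra).
  pose proof (length_gain g _ A Hd) as G. cbv zeta in G.
  set (L := curve_length g) in *. set (L' := curve_length (phi g)) in *.
  assert (E1 : (L' + L) * (c / (2 * M) / 2) <= c / 2).
  { replace (c / 2) with (2 * M * (c / (2 * M) / 2)) by (field; lra).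
    apply Rmult_le_compat_r; lra. }
  assert (E2 : / (2 * (c / (2 * M))) = M / c) by (field; lra).
  rewrite E2 in G.
  set (X := (L' - L) * (M / c)) in *. set (Z := (L' + L) * (c / (2 * M) / 2)) in *.
  assert (E3 : 1 - (X + Z) <= / l).
  { destruct (Rle_lt_dec (1 - (X + Z)) 0) as [N|N]; [lra|].
    apply Rmult_le_reg_l with l; [lra|]. rewrite Rinv_r by lra. nra. }
  assert (E4 : c / 2 <= X) by (unfold c in *; lra).
  apply Rmult_le_reg_r with (M / c); [apply Rdiv_lt_0_compat; lra|].
  fold X. replace (c * c / (2 * M) * (M / c)) with (c / 2) by (field; lra).
  exact E4.
Qed.

Theorem theoremB (gamma0 : curve) (HY : Y gamma0) (Hnt : ~ trivial gamma0) :
  is_lim_seq (fun n : nat => curve_length (Nat.iter n phi gamma0)) p_infty.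
Proof.
  assert (A : forall n, admissible (Nat.iter n phi gamma0)).
  { induction n as [|n IH]; [now apply Y_admissible|]. now apply phi_admissible. }
  set (L := fun n => curve_length (Nat.iter n phi gamma0)).
  assert (Step : forall n, L n <= L (S n)).
  { intros n. apply phi_length_le, A. }
  assert (Mono : forall m n, (m <= n)%nat -> L m <= L n).
  { intros m n Hmn. induction Hmn as [|n _ IH]; [lra|].
    eapply Rle_trans; [exact IH|apply Step]. }
  assert (L0 : 1 < L O).
  { destruct (Rlt_le_dec 1 (L O)) as [G|G]; [exact G|].
    destruct Hnt. now apply short_trivial; [apply (A O)|]. }
  apply is_lim_seq_spec. intros M.
  apply NNPP. intros N.
  assert (B : forall n, L n <= M).
  { intros n. apply Rnot_lt_le. intros Q. apply N. exists n. intros k Hk.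
    eapply Rlt_le_trans; [exact Q|]. now apply Mono. }
  set (e := (1 - / L O) * (1 - / L O) / (2 * M)).
  assert (Gain : forall n, L O + INR n * e <= L n).
  { induction n as [|n IH]; [cbn [INR]; lra|].
    assert (G : e <= L (S n) - L n).
    { exact (length_gain_uniform (Nat.iter n phi gamma0) (L O) M (A n) L0
        (Mono O n (Nat.le_0_l n)) (B (S n))). }
    rewrite S_INR. lra. }
  assert (He : 0 < e).
  { pose proof (Rinv_lt_contravar 1 (L O) ltac:(lra) L0). rewrite Rinv_1 in *.
    specialize (B O). apply Rdiv_lt_0_compat; [|lra]. apply Rmult_lt_0_compat; lra. }
  destruct (archimed_cor1 (e / M)) as (n & Hn & Hn0).
  { specialize (B O). apply Rdiv_lt_0_compat; lra. }
  specialize (Gain n). pose proof (B n). pose proof (B O).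
  apply lt_0_INR in Hn0.
  apply Rmult_lt_compat_r with (r := INR n * M) in Hn; [|apply Rmult_lt_0_compat; lra].
  replace (/ INR n * (INR n * M)) with M in Hn by (field; lra).
  replace (e / M * (INR n * M)) with (INR n * e) in Hn by (field; lra).
  lra.
Qed.
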